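(* Let $K=\{0,1\}$. There exist $\varepsilon>0$, an even integer $N<\infty$, and a Markov chain with law $\mu$ over sequences $$k,c_1,d_1,c_2,d_2,c_3,\dots$$ with $k\in K$ and, for each $l\ge1$, $c_l\in C_l$, $d_l\in D_l$, $C_l=D_l=\{1,\dots,N\}$, such that, defining the sets of signals $C^l=\prod_{p=1}^lC_p$, $D^l=\prod_{p=1}^lD_p$ and the information structures $$u^l=\mathrm{marg}_{K\times C^l\times D^l}\,\mu\qquad(l\ge1),$$ one has, for any $p\ne l$ (with $p,l\ge1$), $$d(u^l,u^p)>\varepsilon.$$
   Context: An information structure is a probability on $K\times S_1\times S_2$ with $S_1,S_2$ at most countable, where $k\in K$ is the state and $S_i$ is the set of signals of player $i$. In $u^l$, player 1's signal is $(c_1,\dots,c_l)\in C^l$ and player 2's signal is $(d_1,\dots,d_l)\in D^l$. $\mathrm{marg}$ denotes the marginal distribution. A payoff function is a map $g:K\times I\times J\to[-1,1]$ with $I,J$ nonempty finite sets; $\mathcal{G}$ is the set of all payoff functions. In the zero-sum Bayesian game $\Gamma(u,g)$, $(k,s_1,s_2)$ is drawn from $u$, player $i$ learns $s_i$, they simultaneously choose $i\in I$ and $j\in J$, and player 1 (the maximizer) receives $g(k,i,j)$ from player 2; $\mathrm{val}(u,g)$ is its value in mixed strategies. The value-based distance is $d(u,v)=\sup_{g\in\mathcal{G}}|\mathrm{val}(u,g)-\mathrm{val}(v,g)|$. *)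

(* Defs.v *)
From HB Require Import structures.
From mathcomp Require Import all_boot all_order all_algebra.
From mathcomp Require Import all_classical all_reals all_analysis.
Set Implicit Arguments.
Unset Strict Implicit.
Unset Printing Implicit Defensive.
Import Order.TTheory GRing.Theory Num.Theory.
Import numFieldNormedType.Exports.
Local Open Scope classical_set_scope.
Local Open Scope ring_scope.

(* Countable signal sets. Nonemptiness is harmless (there is no probability on
   the empty set); measurable types are required to be pointed. *)
#[short(type="pcountType")]
HB.structure Definition PointedCountable := {T of Countable T & isPointed T}.

HB.instance Definition _ (n : nat) := isPointed.Build 'I_n.+1 ord0.
HB.instance Definition _ (n l : nat) := Pointed.on (l.-tuple 'I_n.+1).

Definition discrete (T : Type) : Type := T.

HB.instance Definition _ (T : pointedType) := Pointed.on (discrete T).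
HB.instance Definition _ (T : pointedType) :=
  @isMeasurable.Build default_measure_display (discrete T)
    (@discrete_measurable T) (@discrete_measurable0 T)
    (@discrete_measurableC T) (@discrete_measurableU T).

Local Notation K := 'I_2.

Definition infostruct (R : realType) (S1 S2 : pcountType) :=
  probability (discrete (K * S1 * S2)%type) R.

Section Game.
Variable R : realType.

Definition is_payoff (I J : finType) (g : K -> I -> J -> R) :=
  forall k i j, -1 <= g k i j <= 1.

(* Behavioral strategies S -> Delta(I). *)
Definition strategies (S : Type) (I : finType) : set (S -> I -> R) :=
  [set sigma | forall s, (forall i, 0 <= sigma s i) /\ \sum_i sigma s i = 1].
Arguments strategies : clear implicits.

Variables (S1 S2 : pcountType) (u : infostruct R S1 S2).

Section Value.
Variables (I J : finType) (g : K -> I -> J -> R).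

Definition expected_payoff (sigma : S1 -> I -> R) (tau : S2 -> J -> R) : R :=
  \int[u]_x \sum_i \sum_j sigma x.1.2 i * tau x.2 j * g x.1.1 i j.

Definition maxmin : R :=
  sup [set inf [set expected_payoff sigma tau | tau in strategies S2 J]
      | sigma in strategies S1 I].

Definition minmax : R :=
  inf [set sup [set expected_payoff sigma tau | sigma in strategies S1 I]
      | tau in strategies S2 J].

(* The default 0 is only used if the game has no value. *)
Definition game_val : R := xget 0 [set v | v = maxmin /\ v = minmax].

End Value.
End Game.

(* The elements i0 and j0 witness that the action sets are nonempty. *)
Definition value_dist (R : realType) (S1 S2 T1 T2 : pcountType)
    (u : infostruct R S1 S2) (v : infostruct R T1 T2) : R :=
  sup [set x | exists (I J : finType) (i0 : I) (j0 : J) (g : K -> I -> J -> R),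
    is_payoff g /\ x = `|game_val u g - game_val v g|].

(* Sequences (k, c_1, d_1, c_2, d_2, ...): coordinate 0 is k, coordinate 2p+1
   is c_(p+1) and coordinate 2p+2 is d_(p+1). The signal set {1, ..., n+1} is
   encoded as 'I_n.+1. *)
Section Paths.
Variable n : nat.

Definition coord_type (i : nat) : pointedType :=
  if i is 0 then K else 'I_n.+1.

Definition coord_events : set (set (forall i, coord_type i)) :=
  [set A | exists (i : nat) (a : coord_type i), A = [set w | w i = a]].

Definition paths := g_sigma_algebraType coord_events.

Definition signals1 (l : nat) (w : paths) : l.-tuple 'I_n.+1 :=
  [tuple (w p.*2.+1 : 'I_n.+1) | p < l].

Definition signals2 (l : nat) (w : paths) : l.-tuple 'I_n.+1 :=
  [tuple (w p.*2.+2 : 'I_n.+1) | p < l].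

Definition proj (l : nat) (w : paths) :
    discrete (K * l.-tuple 'I_n.+1 * l.-tuple 'I_n.+1)%type :=
  (w 0%N : K, signals1 l w, signals2 l w).

Lemma measurable_coord (i : nat) (a : coord_type i) :
  measurable [set w : paths | w i = a].
Proof. by apply: sub_sigma_algebra; exists i, a. Qed.

Lemma measurable_proj (l : nat) : measurable_fun setT (@proj l).
Proof.
move=> _ A _; rewrite setTI.
have -> : @proj l @^-1` A = \bigcup_(a in A) (@proj l @^-1` [set a]).
  by rewrite -preimage_bigcup bigcup_imset1 image_id.
apply: fin_bigcup_measurable => [|[[k c] d] _]; first exact: finite_finset.
pose fit (p : 'I_l) : set paths :=
  [set w : paths | w p.*2.+1 = tnth c p] `&`
  [set w : paths | w p.*2.+2 = tnth d p].
have -> : @proj l @^-1` [set (k, c, d)] =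
    [set w : paths | w 0%N = k] `&` \bigcap_(p in [set: 'I_l]) fit p.
  apply/seteqP; split=> w /=.
    case=> wk wc wd; split=> // p _.
    by split=> /=; rewrite -?wc -?wd tnth_mktuple.
  case=> wk wfit; congr (_, _, _) => //; apply: eq_from_tnth => p;
    by rewrite tnth_mktuple; case: (wfit p I).
apply: measurableI; first exact: measurable_coord.
apply: fin_bigcap_measurable => [|p _]; first exact: finite_finset.
by apply: measurableI; exact: measurable_coord.
Qed.

HB.instance Definition _ (l : nat) :=
  isMeasurableFun.Build _ _ _ _ (@proj l) (@measurable_proj l).

Variable R : realType.
Variable mu : probability paths R.

Definition history (i : nat) (x : paths) : set paths :=
  [set w | forall m, (m <= i)%N -> w m = x m].

Definition cond_prob (A B : set paths) : R :=
  fine (mu (A `&` B)) / fine (mu B).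

Definition markov_chain : Prop :=
  forall (i : nat) (x : paths), (0 < mu (history i x))%E ->
    cond_prob [set w | w i.+1 = x i.+1] (history i x) =
    cond_prob [set w | w i.+1 = x i.+1] [set w | w i = x i].

Definition marginal (l : nat) :
    infostruct R (l.-tuple 'I_n.+1) (l.-tuple 'I_n.+1) :=
  distribution mu (@proj l).

End Paths.

(* Main.v *)
From HB Require Import structures.
Require Import Defs.
From mathcomp Require Import all_boot all_order all_algebra all_field.
From mathcomp Require Import all_classical all_reals all_analysis.
From mathcomp Require Import zify ring lra.
Set Implicit Arguments.
Unset Strict Implicit.
Unset Printing Implicit Defensive.
Import Order.TTheory GRing.Theory Num.Theory.
Local Open Scope classical_set_scope.
Local Open Scope ring_scope.

(** Let e be a relation on a finite set of letters, with all in-degrees and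
    out-degrees equal to m, such that for all letters s and t <> t', fewer than
    half of the x with e s x and e x t also satisfy e x t' ([separating]). Draw
    c_1 uniformly, let k be 1 with a probability that determines c_1, and let
    c_1, d_1, c_2, d_2, ... be a uniform random walk along e.

    For l >= 1 consider the game where player 1 announces l + 1 letters, player 2
    announces l letters, and the announcements are read alternately. Player 1 is
    paid a proper score for his first letter, seen as a forecast of k, plus a
    small stake times +1 or -1, according to whether the first step of the
    alternate word that is not in e ends in a letter of player 2 or of player 1
    ([blame]).

    Suppose that the opponent is truthful, that the last truthful letter of a
    player was s, that his next letter is t, and that he announces r <> t instead.
    The hidden letter x between s and t is uniform among those with e s x and
    e x t, so the lie is exposed with probability more than 1/2, and the possible
    gain from the rest of the word never exceeds the loss of an exposed lie. Hence
    lying does not pay ([lie_step], [truthful_gain]). A lie on the first letter is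
    deterred by the score for player 1 ([score_truthful]) and by c_1 for player 2
    ([lie_first]). So if p > l, truthful announcements form a saddle point of this
    game in u^p. In u^l player 1 does not know c_(l+1), and whatever he announces
    instead is refuted by d_l with probability at least 1/m ([lie_last]). Truthful
    play of player 2 then lowers the payoff by at least stake / m, a gap that
    depends neither on l nor on p ([report_game_gap]). The scores are at least
    1/4, so the upper bound obtained in u^l is nonnegative; it therefore holds for
    [game_val] also if the latter is 0 by default ([game_val_le]).

    A relation e is given by (x, y) -> (x', y') iff y' = y + q (x + x') - q x on
    F^4 x F, where F is a finite field and q (u, v) = u . v. The letters between
    two given ones form a translate of a quadric q = c, and a third letter cuts
    it by a hyperplane, which contains less than half of the quadric as soon as
    F has at least 5 elements ([quadric_section]). The field with 8 elements makes
    the number of letters even ([separating_walk]).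

    The law of the chain is the image of the uniform measure on [0, 1[ under a map
    that reads the successive digits of a number in a fixed base and uses each
    digit to draw one transition ([chain_markov], [walk_law_proj]). *)

(** * A separating relation from a quadric over a finite field *)

(** Booleans are summed as 0 and 1, so these sums are cardinals, in a form that
    can be reindexed and cast to a field. *)
Definition biregular (S : finType) (m : nat) (e : rel S) : Prop :=
  (forall s, \sum_t e s t = m)%N /\ (forall t, \sum_s e s t = m)%N.

(** The constant 1/2 is what makes lying unprofitable when exposed and unexposed
    lies are worth -1 and at most 1. *)
Definition separating (S : finType) (e : rel S) : Prop :=
  forall s t t' : S, t != t' ->
    (2 * (\sum_x [&& e s x, e x t & e x t'])%N < (\sum_x (e s x && e x t))%N)%N.

Lemma sum_pair (S T : finType) (P : S * T -> nat) :
  (\sum_p P p = \sum_x \sum_y P (x, y))%N.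
Proof. by rewrite pair_bigA; apply: eq_bigr => -[]. Qed.

Section Quadric.
Variable F : finFieldType.
Local Notation q := #|F|.
Implicit Types (u v : F * F) (p : (F * F) * (F * F)) (c : F).

Definition dot u v : F := u.1 * v.1 + u.2 * v.2.

Lemma dotC u v : dot u v = dot v u.
Proof. by rewrite /dot ![v.1 * _]mulrC ![v.2 * _]mulrC. Qed.

Lemma sum_affine (a b c : F) : a != 0 -> (\sum_(x : F) (a * x + b == c)%R = 1)%N.
Proof.
move=> a0; rewrite (bigD1 (a^-1 * (c - b))) //= mulVKf // subrK eqxx.
rewrite big1 ?addn0 // => x /negPf; apply: contraFeq.
by rewrite eqb0 negbK => /eqP <-; rewrite addrK mulKf.
Qed.

Lemma sum_dot u c : u != 0 -> (\sum_v (dot u v == c) = q)%N.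
Proof.
case: u => u1 u2; rewrite -pair_eqE /= negb_and => /orP[] u0.
- rewrite sum_pair.
  rewrite exchange_big /= -sum1_card; apply: eq_bigr => v2 _.
  by rewrite -(sum_affine (u2 * v2) c u0).
- rewrite sum_pair.
  rewrite -sum1_card; apply: eq_bigr => v1 _.
  rewrite -(sum_affine (u1 * v1) c u0); apply: eq_bigr => v2 _.
  by rewrite /dot /= addrC.
Qed.

Lemma sum_bool_le1 (T : finType) (P : pred T) :
  (forall x y, P x -> P y -> x = y) -> (\sum_x P x <= 1)%N.
Proof.
move=> Puniq; case: (pickP P) => [x Px|P0]; last by rewrite big1 // => x _; rewrite P0.
rewrite (bigD1 x) //= big1 ?addn0 ?Px // => y yx.
by apply/eqP; rewrite eqb0; apply: contra yx => Py; rewrite (Puniq _ _ Py Px).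
Qed.

(** Each of the q^2 - 1 nonzero vectors u contributes a line of solutions v. *)
Lemma quadric_lower c :
  ((q ^ 2 - 1) * q <= \sum_u \sum_v (dot u v == c))%N.
Proof.
rewrite (bigD1 (0 : F * F)) //=.
apply: leq_trans (leq_addl _ _).
rewrite (eq_bigr (fun=> q)) => [|u u0]; last exact: sum_dot.
by rewrite sum_nat_const leq_mul2r (@cardC1 (F * F)%type) card_prod mulnn subn1 leqnn orbT.
Qed.

(** For u not proportional to b, the two linear conditions on v are independent
    and have one solution. Each of the q vectors u proportional to b contributes
    at most a line. *)
Lemma quadric_section_upper (a b : F * F) c d : b != 0 ->
  (\sum_u \sum_v ((dot u v == c) && (dot a u + dot b v == d))%R <= 2 * q ^ 2)%N.
Proof.
move=> b0.
(* A vector u is proportional to b iff it is orthogonal to (b.2, - b.1). *)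
have b'0 : (b.2, - b.1) != 0 :> F * F.
  move: b0; rewrite -!pair_eqE /= oppr_eq0 !negb_and; by rewrite orbC.
have fib u : (\sum_v ((dot u v == c) && (dot a u + dot b v == d))%R <=
    1 + (dot (b.2, - b.1) u == 0%R) * q)%N.
  case: (boolP (_ == 0%R)) => [_|det].
    rewrite mul1n; apply: (leq_trans _ (leq_addl _ _)).
    rewrite -(sum_dot (d - dot a u) b0); apply: leq_sum => v _.
    case: (dot u v == c) => //=.
    by rewrite addrC -[in leqRHS](inj_eq (addIr (dot a u))) subrK.
  rewrite mul0n addn0; apply: sum_bool_le1 => v w.
  move=> /andP[/eqP v1 /eqP v2] /andP[/eqP w1 /eqP w2].
  have e1 : dot u v = dot u w by rewrite v1 w1.
  have e2 : dot b v = dot b w by apply: (addrI (dot a u)); rewrite v2 w2.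
  move: det e1 e2; rewrite /dot; case: u v w b {v1 v2 w1 w2 b0 b'0} =>
    [u1 u2] [v1 v2] [w1 w2] [b1 b2] /= det e1 e2.
  congr (_, _); apply: (mulfI det); apply/eqP; rewrite -subr_eq0; apply/eqP.
  - transitivity (b2 * ((u1 * v1 + u2 * v2) - (u1 * w1 + u2 * w2)) -
                  u2 * ((b1 * v1 + b2 * v2) - (b1 * w1 + b2 * w2))).
      ring.
    by rewrite e1 e2 !subrr !mulr0 subrr.
  - transitivity (u1 * ((b1 * v1 + b2 * v2) - (b1 * w1 + b2 * w2)) -
                  b1 * ((u1 * v1 + u2 * v2) - (u1 * w1 + u2 * w2))).
      ring.
    by rewrite e1 e2 !subrr !mulr0 subrr.
apply: (@leq_trans (\sum_u (1 + (dot (b.2, - b.1) u == 0)%R * q))).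
  by apply: leq_sum => u _.
by rewrite big_split /= sum1_card card_prod -big_distrl /= sum_dot // mulnn; lia.
Qed.

(** The bounds 2 q^2 and q (q^2 - 1) on the section and on the quadric suffice
    from q = 5 on, and the case b = 0 follows by exchanging u and v. *)
Lemma quadric_section (a b : F * F) c d : (4 < q)%N -> (a, b) != 0 ->
  (2 * (\sum_u \sum_v ((dot u v == c) && (dot a u + dot b v == d))%R)%N
     < (\sum_u \sum_v (dot u v == c))%N)%N.
Proof.
move=> q5 ab0.
apply: leq_trans (quadric_lower c).
suff h : (\sum_u \sum_v ((dot u v == c) && (dot a u + dot b v == d))%R <= 2 * q ^ 2)%N.
  by rewrite expnS expn1 in h *; nia.
move: ab0; rewrite -pair_eqE /= negb_and orbC => /orP[b0|a0].
  exact: quadric_section_upper.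
rewrite exchange_big /=; apply: leq_trans (quadric_section_upper b c d a0).
apply: leq_sum => u _; apply: leq_sum => v _.
by rewrite dotC addrC.
Qed.

Definition state : finType := ((F * F) * (F * F) * F)%type.

Definition quad p : F := dot p.1 p.2.

(** With <x, x'> the polar form of [quad], the right-hand side is
    s.2 + <x, x'> + quad x'. The first component of a successor is free and
    determines the second one, and likewise for a predecessor. *)
Definition qwalk : rel state :=
  fun s t => t.2 == s.2 + quad (s.1 + t.1) - quad s.1.

Lemma sum_pred1 (T : finType) (c : T) : (\sum_x (x == c) = 1)%N.
Proof. by rewrite (bigD1 c) //= eqxx big1 // => x /negPf ->. Qed.

Lemma qwalk_biregular : biregular (q ^ 4)%N qwalk.
Proof.
have qX : (q ^ 4 = \sum_(x : (F * F) * (F * F)) 1)%N.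
  by rewrite sum1_card !card_prod !expnS expn0 muln1 !mulnA.
split=> s; rewrite sum_pair qX; apply: eq_bigr => x _.
  exact: (sum_pred1 (s.2 + quad (s.1 + x) - quad s.1)).
rewrite -(sum_pred1 (s.2 - quad (x + s.1) + quad x)); apply: eq_bigr => c _.
rewrite /qwalk /= -subr_eq0 -[in RHS]subr_eq0 -[in RHS]oppr_eq0.
by congr (nat_of_bool (_ == _)); ring.
Qed.

Lemma sum_qwalkl (P : pred state) s :
  (\sum_t (qwalk s t && P t) =
   \sum_(p : (F * F) * (F * F)) P (p, s.2 + quad (s.1 + p) - quad s.1)%R)%N.
Proof.
rewrite sum_pair; apply: eq_bigr => p _.
rewrite (bigD1 (s.2 + quad (s.1 + p) - quad s.1)) //= /qwalk /= eqxx /=.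
by rewrite big1 ?addn0 // => c /negPf ->.
Qed.

(** Completing the square: the states between s and t form a translate of a level
    set of [quad]. *)
Lemma qwalk_two_stepsE s t p :
  qwalk (p, s.2 + quad (s.1 + p) - quad s.1) t =
  (quad (p + (s.1 + t.1)) == t.2 - s.2 + quad (s.1 + t.1) - quad t.1).
Proof.
rewrite /qwalk -subr_eq0 -[in RHS]subr_eq0 -[in RHS]oppr_eq0; congr (_ == _).
by case: s t p => [[[a1 a2] [a3 a4]] ya] [[[b1 b2] [b3 b4]] yb] [[p1 p2] [p3 p4]];
  rewrite /quad /dot /=; ring.
Qed.

(** Since quad (p + t.1) - quad (p + t'.1) is affine in p, a second target t'
    cuts the level set given by s and t by a hyperplane; if t and t' have the same
    first component, no state leads to both. *)
Lemma qwalk_separating : (4 < q)%N -> separating qwalk.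
Proof.
move=> q5 s t t' tt'.
rewrite (sum_qwalkl (fun x => qwalk x t && qwalk x t')) (sum_qwalkl (qwalk^~ t)). cbv beta.
set z := s.1 + t.1; set k := t.2 - s.2 + quad z - quad t.1.
pose d := t'.1 - t.1.
pose l := t'.2 - t.2 - quad t'.1 + quad t.1 + (dot d.2 z.1 + dot d.1 z.2).
have -> : (\sum_(p : (F * F) * (F * F))
      qwalk (p, s.2 + quad (s.1 + p) - quad s.1)%R t =
    \sum_u \sum_v (dot u v == k))%N.
  rewrite -(sum_pair (fun p => (quad p == k) : nat)).
  rewrite [RHS](reindex_inj (addIr z)) /=; apply: eq_bigr => p _.
  by rewrite qwalk_two_stepsE.
have N3 : (\sum_(p : (F * F) * (F * F))
      (qwalk (p, s.2 + quad (s.1 + p) - quad s.1)%R t &&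
       qwalk (p, s.2 + quad (s.1 + p) - quad s.1)%R t') <=
    \sum_(p : (F * F) * (F * F))
      ((quad p == k) && (dot d.2 p.1 + dot d.1 p.2 == l))%R)%N.
  rewrite [leqRHS](reindex_inj (addIr z)) /=; apply: leq_sum => p _.
  rewrite -(qwalk_two_stepsE s t).
  case: (boolP (qwalk _ t)) => //= st; rewrite -(subr_eq0 _ l).
  move: st; rewrite /qwalk /= => /eqP st; rewrite -subr_eq0 -oppr_eq0.
  rewrite leq_eqVlt; apply/orP; left; apply/eqP; congr (nat_of_bool (_ == _)).
  rewrite /l /d /z st.
  case: s t t' p {tt' z k d l st} => [[[a1 a2] [a3 a4]] ya] [[[b1 b2] [b3 b4]] yb].
  case=> [[[c1 c2] [c3 c4]] yc] [[p1 p2] [p3 p4]]; rewrite /quad /dot /=.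
  ring.
have [d0|d0] := eqVneq t.1 t'.1.
  suff -> : (\sum_(p : (F * F) * (F * F))
      (qwalk (p, s.2 + quad (s.1 + p) - quad s.1)%R t &&
       qwalk (p, s.2 + quad (s.1 + p) - quad s.1)%R t') = 0)%N.
    rewrite muln0; apply: leq_trans (quadric_lower k).
    by rewrite expnS expn1; nia.
  rewrite big1 // => p _; apply/eqP; rewrite eqb0 /qwalk /= -d0.
  apply: contraNN tt' => /andP[/eqP tE /eqP tE'].
  by apply/eqP; case: t t' d0 tE tE' {z k d l N3} => [a b] [a' b'] /= -> -> ->.
apply: leq_ltn_trans (leq_mul (leqnn 2) N3) _.
rewrite (sum_pair (fun p => (quad p == k) && (dot d.2 p.1 + dot d.1 p.2 == l)%R : nat)).
apply: quadric_section => //.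
apply: contra_neq d0 => dE; apply/esym/eqP; rewrite -subr_eq0 -/d.
by case: d dE {l N3} => d1 d2 /= [-> ->].
Qed.

End Quadric.

(** The number of letters is 8 ^ 5, hence even. *)
Lemma separating_walk : exists (n m : nat) (e : rel 'I_n.+1),
  [/\ (0 < n)%N, ~~ odd n.+1, biregular m e & separating e].
Proof.
have [F _ Fcard] := @PrimePowerField 2 3 isT isT.
have S0 : (1 < #|{: state F}|)%N.
  by rewrite !card_prod Fcard.
pose n := #|{: state F}|.-1.
have nE : n.+1 = #|{: state F}| by rewrite /n prednK // (ltn_trans _ S0).
pose g (i : 'I_n.+1) : state F := enum_val (cast_ord nE i).
have g_bij : bijective g.
  exists (fun s => cast_ord (esym nE) (enum_rank s)) => [i|s].
    by rewrite /g enum_valK cast_ordK.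
  by rewrite /g cast_ordKV enum_rankK.
have gE (P : state F -> nat) : (\sum_i P (g i) = \sum_s P s)%N.
  by rewrite (reindex g) //; exact: onW_bij.
exists n, (#|F| ^ 4)%N, (fun i j => qwalk (g i) (g j)); split.
- by rewrite -ltnS nE.
- by rewrite nE !card_prod !oddM Fcard.
- have [Ho Hi] := qwalk_biregular F.
  by split=> i; [rewrite -(Ho (g i)) -gE | rewrite -(Hi (g i)) -gE].
- move=> s t t' tt'.
  rewrite (gE (fun x => [&& qwalk (g s) x, qwalk x (g t) & qwalk x (g t')] : nat)).
  rewrite (gE (fun x => (qwalk (g s) x && qwalk x (g t)) : nat)).
  by apply: qwalk_separating; rewrite ?Fcard // (bij_eq g_bij).
Qed.

(** Sum the separation inequality over s: each x has m predecessors. *)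
Lemma separating_pred (S : finType) (m : nat) (e : rel S) :
  biregular m e -> separating e -> forall t t' : S, t != t' ->
  (2 * (\sum_x (e x t && e x t'))%N <= \sum_x e x t)%N.
Proof.
move=> [_ indeg] sep t t' tt'.
have count (P : pred S) : (\sum_s \sum_x (e s x && P x) = m * \sum_x P x)%N.
  rewrite exchange_big big_distrr /=; apply: eq_bigr => x _.
  rewrite -(indeg x) big_distrl /=; apply: eq_bigr => s _.
  by case: (e s x); case: (P x).
have : (m * (2 * (\sum_x (e x t && e x t'))) <= m * (\sum_x e x t))%N.
  rewrite mulnCA -!count big_distrr; apply: leq_sum => s _ /=.
  exact/ltnW/sep.
rewrite leq_mul2l => /orP[/eqP m0|//].
rewrite big1 // => x _; apply/eqP; rewrite eqb0; apply/negP => /andP[ext _].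
by move: (indeg t); rewrite m0 (bigD1 x) //= ext.
Qed.

(** If all successors of s led to t, then for t' <> t all states between s and t'
    would also lead to t, which separation forbids. *)
Lemma separating_escape (S : finType) (e : rel S) :
  separating e -> (1 < #|S|)%N -> forall s t : S, exists x, e s x && ~~ e x t.
Proof.
move=> sep S1 s t.
have /card_gt0P [t'] : (0 < #|predC1 t|)%N by rewrite cardC1; lia.
rewrite inE /= => t't.
apply/existsP; apply: contraT; rewrite negb_exists => /forallP h.
have := sep s t' t t't; rewrite (eq_bigr (fun x => (e s x && e x t') : nat)); first by lia.
move=> x _; move: (h x); rewrite negb_and negbK.
by case: (e s x); case: (e x t); case: (e x t').
Qed.

(** * Words: sums over them and alternation of two of them *)

Section SequenceSum.
Variables (R : numDomainType) (S : finType).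
Implicit Types F G : seq S -> R.

(** Summing functions of bare sequences makes inductions on the length possible
    without casts between tuple types. *)
Definition seqsum (h : nat) F : R := \sum_(t : h.-tuple S) F t.

Lemma seqsum0 F : seqsum 0 F = F [::].
Proof.
rewrite /seqsum (bigD1 [tuple]) //= big1 ?addr0 // => t /eqP[]; exact: tuple0.
Qed.

Lemma seqsumS h F : seqsum h.+1 F = \sum_a seqsum h (fun t => F (a :: t)).
Proof.
rewrite /seqsum pair_bigA /=.
rewrite (reindex (fun p : S * h.-tuple S => [tuple of p.1 :: p.2])) //=.
exists (fun t => (thead t, [tuple of behead t])) => [[a t] _|t _] /=.
  by rewrite theadE; congr pair; apply: val_inj.
by rewrite [RHS]tuple_eta.
Qed.

Lemma eq_seqsum h F G : (forall t, size t = h -> F t = G t) -> seqsum h F = seqsum h G.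
Proof. by move=> FG; apply: eq_bigr => t _; rewrite FG ?size_tuple. Qed.

Lemma ler_seqsum h F G :
  (forall t, size t = h -> F t <= G t) -> seqsum h F <= seqsum h G.
Proof. by move=> FG; apply: ler_sum => t _; rewrite FG ?size_tuple. Qed.

Lemma seqsumZ h c F : seqsum h (fun t => c * F t) = c * seqsum h F.
Proof. by rewrite /seqsum big_distrr. Qed.

Lemma seqsumD h F G : seqsum h (fun t => F t + G t) = seqsum h F + seqsum h G.
Proof. exact: big_split. Qed.

Lemma seqsum_ge0 h F : (forall t, 0 <= F t) -> 0 <= seqsum h F.
Proof. by move=> F0; apply: sumr_ge0. Qed.

End SequenceSum.

(** When s is one longer than t, the word ends with the last letter of s; this is
    the shape of d_1, c_2, d_2, ..., c_l, d_l. *)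
Fixpoint interleave (T : Type) (s t : seq T) : seq T :=
  if s is a :: s' then a :: (if t is b :: t' then b :: interleave s' t' else [::])
  else [::].

(** Crossing one edge of the walk exchanges the roles of the two players. *)
Lemma interleave_cons (T : Type) (a : T) s t :
  interleave (a :: s) t = a :: interleave t s.
Proof.
elim: s a t => [|b s IH] a [|c t] //=; congr [:: a, c & _].
by case: t => // d t; rewrite -IH.
Qed.

Lemma size_interleave (T : Type) (s t : seq T) : size s = size t ->
  size (interleave s t) = (size s).*2.
Proof. by elim: s t => [|a s IH] [|b t] //= [st]; rewrite IH. Qed.

Lemma nth_interleave (T : Type) (x : T) (s t : seq T) p : size s = size t ->
  nth x (interleave s t) p.*2 = nth x s p /\
  nth x (interleave s t) p.*2.+1 = nth x t p.
Proof.
elim: s t p => [|a s IH] [|b t] [|p] //= [st]; by [rewrite !nth_nil|exact: IH].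
Qed.

(** * Random walks and the price of lying *)

Section Walk.
Variables (R : realFieldType) (S : finType) (m : nat) (e : rel S).
Hypotheses (e_biregular : biregular m e) (e_sep : separating e).
Hypothesis S1 : (1 < #|S|)%N.

Definition step_prob (s t : S) : R := (e s t)%:R / m%:R.

Fixpoint walk_prob (a : S) (s : seq S) : R :=
  if s is b :: s' then step_prob a b * walk_prob b s' else 1.

(** The value sg if the first step of a :: s outside e is at an odd position, - sg
    if it is at an even position, and 0 if a :: s is an e-path. *)
Fixpoint blame (sg : R) (a : S) (s : seq S) : R :=
  if s is b :: s' then if e a b then blame (- sg) b s' else sg else 0.

Lemma blameN sg a s : blame (- sg) a s = - blame sg a s.
Proof.
elim: s sg a => [|b s IH] sg a /=; first by rewrite oppr0.
by case: ifP => // _; rewrite IH.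
Qed.

Lemma norm_blame sg a s : `|blame sg a s| <= `|sg|.
Proof.
elim: s sg a => [|b s IH] sg a /=; first by rewrite normr0.
by case: ifP => // _; rewrite blameN normrN.
Qed.

Lemma blame1_le a s : blame 1 a s <= 1.
Proof. by have := norm_blame 1 a s; rewrite normr1 ler_norml => /andP[]. Qed.

Lemma degree_gt0 : (0 < m)%N.
Proof.
have /card_gt0P[s _] : (0 < #|S|)%N by lia.
have [x /andP[sx _]] := separating_escape e_sep S1 s s.
by case: e_biregular => /(_ s) <- _; rewrite (bigD1 x) //= sx.
Qed.

Lemma step_prob_ge0 s t : 0 <= step_prob s t.
Proof. by rewrite divr_ge0. Qed.

Lemma walk_prob_ge0 a s : 0 <= walk_prob a s.
Proof. by elim: s a => //= b s IH a; rewrite mulr_ge0 ?step_prob_ge0. Qed.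

Lemma walk_prob_rcons a s b :
  walk_prob a (rcons s b) = walk_prob a s * step_prob (last a s) b.
Proof.
elim: s a => [|c s IH] a /=; first by rewrite mulr1 mul1r.
by rewrite IH mulrA.
Qed.

Lemma sum_step_prob s : \sum_t step_prob s t = 1.
Proof.
rewrite -big_distrl -natr_sum /=; case: e_biregular => -> _.
by rewrite divff // pnatr_eq0 -lt0n degree_gt0.
Qed.

(** A player whose last truthful letter is s and whose next one is t announces r
    instead. He loses 1 when the hidden letter x does not lead to r, and gains at
    most 1 afterwards. The numerators 2 N3 < N2 are integers and N2 <= m, whence
    the factor 1 / m. *)
Lemma lie_step s t r : r != t ->
  \sum_x step_prob s x * step_prob x t * (if e x r then 1 else -1) <=
  - m%:R^-1 * \sum_x step_prob s x * step_prob x t.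
Proof.
move=> rt.
pose N2 := (\sum_x (e s x && e x t))%N.
pose N3 := (\sum_x [&& e s x, e x t & e x r])%N.
have sep : (2 * N3 < N2)%N by apply: e_sep; rewrite eq_sym.
have N2m : (N2 <= m)%N.
  by case: e_biregular => /(_ s) <- _; apply: leq_sum => x _; case: (e s x); case: (e x t).
have m0 := degree_gt0.
have mR0 : m%:R != 0 :> R by rewrite pnatr_eq0 -lt0n.
have -> : \sum_x step_prob s x * step_prob x t = N2%:R / m%:R ^+ 2.
  rewrite natr_sum big_distrl; apply: eq_bigr => x _ /=.
  by rewrite /step_prob; case: (e s x); case: (e x t) => /=; field.
have -> : \sum_x step_prob s x * step_prob x t * (if e x r then 1 else -1) =
    (2 * N3%:R - N2%:R) / m%:R ^+ 2.
  rewrite !natr_sum big_distrr -sumrB big_distrl; apply: eq_bigr => x _ /=.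
  by rewrite /step_prob; case: (e s x); case: (e x t); case: (e x r) => /=; field.
rewrite mulrA ler_pM2r ?invr_gt0 ?exprn_gt0 ?ltr0n //.
have : N2%:R / m%:R <= 1 :> R by rewrite ler_pdivrMr ?ltr0n // mul1r ler_nat.
have : (2 * N3)%:R + 1 <= N2%:R :> R by rewrite natr1 ler_nat.
rewrite natrM mulNr mulrC; lra.
Qed.

(** After s, some hidden letter does not lead to r. *)
Lemma lie_last s r :
  \sum_x step_prob s x * (if e x r then 0 else -1) <= - m%:R^-1.
Proof.
have [x /andP[sx xr]] := separating_escape e_sep S1 s r.
rewrite (bigD1 x) //= (negPf xr) /step_prob sx mulrN1 mul1r gerDl.
apply: sumr_le0 => y _; rewrite mulr_ge0_le0 ?step_prob_ge0 //.
by case: ifP; rewrite ?lerN10.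
Qed.

(** The same comparison as in [lie_step], when no letter precedes x. *)
Lemma lie_first t r : r != t ->
  \sum_x step_prob x t * (if e x r then 1 else -1) <= 0.
Proof.
move=> rt; have m0 := degree_gt0.
have := separating_pred e_biregular e_sep (t := t) (t' := r).
rewrite eq_sym => /(_ rt); rewrite -(ler_nat R) natrM !natr_sum => h.
have -> : \sum_x step_prob x t * (if e x r then 1 else -1) =
   (2 * (\sum_x (e x t && e x r)%:R) - \sum_x (e x t)%:R) / m%:R.
  rewrite big_distrr -sumrB big_distrl; apply: eq_bigr => x _ /=.
  by rewrite /step_prob; case: (e x t); case: (e x r) => /=; ring.
by rewrite pmulr_lle0 ?invr_gt0 ?ltr0n // subr_le0.
Qed.

(** The player knows c and cs and has announced c truthfully; rs are his further
    announcements. The h hidden letters ds belong to his truthful opponent, who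
    announces the first n of them. With kappa = 0 this says that lying does not
    pay. With kappa = 1 / m one more letter has to be announced than is known, and
    even a player who never lies about a known letter loses when he guesses the
    last one. Both cases share one induction on h: a truthful letter leads back to
    the same situation, a false one is settled by [lie_step], since the remaining
    blame is at most 1. *)
Lemma truthful_gain (kappa : R) h n c cs rs :
  (h <= (size cs).+1)%N ->
  kappa = 0 \/ [/\ kappa = m%:R^-1, h = (size cs).+1, (h <= n)%N & (h <= size rs)%N] ->
  seqsum h (fun ds => walk_prob c (interleave ds cs) *
                      blame 1 c (interleave (take n ds) rs)) <=
  - kappa * seqsum h (fun ds => walk_prob c (interleave ds cs)).
Proof.
elim: h n c cs rs => [|h IH] n c cs rs hcs hk.
  by rewrite !seqsum0 /= mulr0; case: hk => [->|[]//]; rewrite oppr0 mul0r.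
case: n hk => [|n] hk.
  case: hk => [->|[]//]; rewrite oppr0 mul0r (eq_seqsum (G := fun=> 0)).
    by rewrite /seqsum big1.
  by move=> ds _; rewrite take0 mulr0.
case: rs hk => [|r rs] hk.
  case: hk => [->|[]//]; rewrite oppr0 mul0r; apply: sumr_le0 => -[ds /= _] _.
  case: ds => [|d ds] /=; rewrite ?mulr0 // /step_prob.
  by case: ifP; rewrite !(mul0r, mulr0).
rewrite !seqsumS /=.
case: cs hcs hk => [|c2 cs] hcs hk.
  have {hcs} -> : h = 0%N by move: hcs => /=; lia.
  under eq_bigr do rewrite seqsum0 /= mulr1.
  under [X in _ <= _ * X]eq_bigr do rewrite seqsum0 /= mulr1.
  rewrite sum_step_prob mulr1.
  apply: (@le_trans _ _ (\sum_x step_prob c x * (if e x r then 0 else -1))).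
    apply: ler_sum => x _; rewrite /step_prob; case: ifP; rewrite ?mul0r //.
  apply: le_trans (lie_last c r) _; rewrite lerN2.
  by case: hk => [->|[-> *]//]; rewrite invr_ge0.
pose w x := step_prob c x * step_prob x c2.
have w0 x : 0 <= w x by rewrite mulr_ge0 ?step_prob_ge0.
pose T := seqsum h (fun ds => walk_prob c2 (interleave ds cs)).
have T0 : 0 <= T by apply: seqsum_ge0 => ds; exact: walk_prob_ge0.
have -> : \sum_a seqsum h (fun t => step_prob c a *
    (step_prob a c2 * walk_prob c2 (interleave t cs))) = (\sum_x w x) * T.
  rewrite big_distrl; apply: eq_bigr => x _ /=.
  by rewrite /T -seqsumZ; apply: eq_seqsum => t _; rewrite /w; ring.
have -> : \sum_a seqsum h (fun t => step_prob c a *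
    (step_prob a c2 * walk_prob c2 (interleave t cs)) *
    (if e c a then if e a r then blame (- - 1) r (interleave (take n t) rs)
                   else -1 else 1)) =
   \sum_x w x * seqsum h (fun t => walk_prob c2 (interleave t cs) *
       (if e x r then blame 1 r (interleave (take n t) rs) else -1)).
  apply: eq_bigr => x _; rewrite -seqsumZ; apply: eq_seqsum => t _.
  by rewrite /w /step_prob opprK; case: (e c x); case: (e x c2); case: (e x r); rewrite /=; ring.
(* Either the next letter is announced truthfully, or the lie is settled now. *)
have [rE|rN] := eqVneq r c2.
  rewrite {}rE in hk *; rewrite mulrCA [leRHS]big_distrl; apply: ler_sum => x _ /=.
  case: (boolP (e x c2)) => xc2; last by rewrite /w /step_prob (negPf xc2) mul0r mulr0 !mul0r.
  apply: ler_wpM2l => //.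
  apply: IH; first by [].
  by case: hk => [->|[-> [->] *]]; [left|right].
apply: (@le_trans _ _ ((\sum_x w x * (if e x r then 1 else -1)) * T)).
  rewrite big_distrl; apply: ler_sum => x _ /=; rewrite -mulrA.
  apply: ler_wpM2l => //; rewrite /T -seqsumZ; apply: ler_seqsum => t _.
  rewrite mulrC ler_wpM2r ?walk_prob_ge0 //; case: ifP => // _; exact: blame1_le.
rewrite mulrA; apply: ler_wpM2r => //.
apply: (@le_trans _ _ (- m%:R^-1 * \sum_x w x)); first exact: lie_step.
apply: ler_wpM2r; first by apply: sumr_ge0 => x _.
by rewrite lerN2; case: hk => [->|[-> *]//]; rewrite invr_ge0.
Qed.

End Walk.

(** * Digits of a uniform number *)

Section Digits.
Variable R : realType.
Implicit Types (x : R) (k b : nat) (B : pred nat).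

Definition unif01 : set (measurableTypeR R) -> \bar R :=
  mrestr (@lebesgue_measure R) (measurable_itv `[0%R, 1%R[).

HB.instance Definition _ := Measure.copy unif01
  (mrestr (@lebesgue_measure R) (measurable_itv `[0%R, 1%R[)).

Lemma unif01_setT : unif01 setT = 1%E.
Proof. by rewrite /unif01 /mrestr setTI lebesgue_measure_itv /= lte_fin ltr01 sube0. Qed.

HB.instance Definition _ := Measure_isProbability.Build _ _ _ unif01 unif01_setT.

(** For x in [0, 1[, the integer with base b digits the first k digits of x. *)
Definition leading b k x : nat := Num.truncn (x * b%:R ^+ k).

Lemma leadingS b k x : (0 < b)%N -> 0 <= x ->
  (leading b k.+1 x %/ b = leading b k x)%N.
Proof.
move=> b0 x0; apply/esym/truncn_def.
have y0 : 0 <= x * b%:R ^+ k.+1 by rewrite mulr_ge0 ?exprn_ge0.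
have bR : 0 < b%:R :> R by rewrite ltr0n.
have /andP[h1 h2] := truncn_itv y0.
rewrite -/(leading b k.+1 x) in h1 h2; set N := leading _ _ _ in h1 h2 *.
rewrite -(ler_pM2r bR) -(ltr_pM2r bR) -mulrA -exprSr -!natrM.
rewrite (le_trans _ h1) ?ler_nat ?leq_trunc_div //=.
by rewrite (lt_le_trans h2) // ler_nat ltn_ceil.
Qed.

Lemma measurable_leading b k B : (0 < b)%N -> measurable [set x | B (leading b k x)].
Proof.
move=> b0.
have c0 : 0 < b%:R ^+ k :> R by rewrite exprn_gt0 ?ltr0n.
have mle N : measurable [set x | (leading b k x <= N)%N].
  rewrite (_ : [set x | _] = `]-oo, (N.+1%:R / b%:R ^+ k)[%classic) //.
  by apply/seteqP; split=> x /=; rewrite in_itv /= /leading truncn_le_nat ltr_pdivlMr.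
have mlt N : measurable [set x | (leading b k x < N)%N].
  case: N => [|N]; last exact: mle.
  by rewrite (_ : [set x | _] = set0) // -subset0 => x.
rewrite (_ : [set x | _] = \bigcup_(N in [set N | B N])
   ([set x | (leading b k x <= N)%N] `\` [set x | (leading b k x < N)%N])).
  by apply: bigcup_measurable => N _; apply: measurableD.
apply/seteqP; split=> [x Bx|x [N BN [/= h1 h2]]].
  by exists (leading b k x) => //; split => /=; rewrite ?ltnn.
suff -> : leading b k x = N by [].
by apply/eqP; rewrite eqn_leq h1 leqNgt; apply/negP.
Qed.

(** The first k digits are uniform on the integers below b ^ k: they are N exactly
    on the interval [N / b ^ k, (N + 1) / b ^ k[. *)
Lemma unif01_leading b k B : (0 < b)%N ->
  unif01 [set x | B (leading b k x)] = ((\sum_(0 <= N < b ^ k) B N)%N%:R / b%:R ^+ k)%:E.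
Proof.
move=> b0.
have c0 : 0 < b%:R ^+ k :> R by rewrite exprn_gt0 ?ltr0n.
pose I (N : nat) := `[(N%:R / b%:R ^+ k), (N.+1%:R / b%:R ^+ k)[%classic : set R.
have IE N x : I N x <-> 0 <= x /\ leading b k x = N.
  rewrite /I /= in_itv /= ler_pdivrMr // ltr_pdivlMr //; split.
    move=> h; split; last exact: truncn_def.
    by case/andP: h => h _; rewrite -(pmulr_lge0 _ c0) (le_trans _ h).
  by case=> x0 <-; apply: truncn_itv; rewrite mulr_ge0 // ltW.
rewrite /unif01 /mrestr.
have lt1 x : 0 <= x -> (leading b k x < b ^ k)%N = (x < 1).
  move=> x0; rewrite truncn_lt_nat; last by rewrite mulr_ge0 // ltW.
  by rewrite natrX gtr_pMl.
pose J N := if B N then I N else set0.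
rewrite (_ : _ `&` _ = \big[setU/set0]_(N < (b ^ k)%N) J N); last first.
  rewrite -bigcup_mkord; apply/seteqP; split=> x /=.
    rewrite in_itv /= => -[Bx /andP[x0 x1]].
    by exists (leading b k x); rewrite /= ?lt1 // /J Bx; apply/IE.
  case=> N /= Nlt; rewrite /J; case: ifP => // BN /IE[x0 NE].
  by rewrite NE in_itv /= x0; split => //; rewrite -lt1 // NE.
have mJ N : measurable (J N).
  by rewrite /J; case: ifP => _; [exact: measurable_itv | exact: measurable0].
rewrite measure_bigsetU //; last first.
  apply/trivIsetP => i j _ _ ij; rewrite /J; case: ifP; case: ifP; rewrite ?set0I ?setI0 // => _ _.
  rewrite -subset0 => x [/IE[_ iE] /IE[_ jE]].
  by rewrite -iE jE eqxx in ij.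
rewrite big_mkord natr_sum big_distrl -sumEFin; apply: eq_bigr => N _.
rewrite /J; case: (B N) => /=; last by rewrite measure0 mul0r.
rewrite /I lebesgue_measure_itv /= lte_fin ltr_pM2r ?invr_gt0 // ltr_nat ltnSn.
by rewrite -EFinB -mulrBl -natrB // subSnn.
Qed.

End Digits.

Lemma sum_last_digit (b k : nat) (B C : pred nat) : (0 < b)%N ->
  (\sum_(0 <= N < b ^ k.+1) (B (N %/ b)%N && C (N %% b)%N) =
   (\sum_(0 <= N < b ^ k) B N) * \sum_(0 <= r < b) C r)%N.
Proof.
move=> b0; rewrite expnSr big_nat_mul big_distrl; apply: eq_bigr => N _ /=.
rewrite -{1}[(N * b)%N]add0n big_addn mulSn addnK big_distrr /=.
rewrite big_nat [in RHS]big_nat; apply: eq_bigr => r /= rb.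
by rewrite addnC divnMDl // divn_small // addn0 modnMDl modn_small // mulnb.
Qed.

(** * Markov chains driven by independent digits *)

Section Chain.
Variables (R : realType) (n : nat) (T : finType) (t0 : T).
Local Notation L := 'I_n.+1.
Variables (f0 : T -> 'I_2 * L) (stp : L -> T -> L).
Local Notation b := #|T|.

Let b_gt0 : (0 < b)%N. Proof. by apply/card_gt0P; exists t0. Qed.

Definition digit (N : nat) : T := nth t0 (enum T) N.

Lemma sum_digit (P : pred T) : (\sum_(0 <= r < b) P (digit r) = \sum_t P t)%N.
Proof. by rewrite -[RHS]big_enum (big_nth t0) -cardE. Qed.

(** The letter number i + 1 of the path, as a function of the integer N whose base
    #|T| digits are the i + 1 first digits of the driving number. *)
Fixpoint chain_state (i N : nat) : L :=
  if i is j.+1 then stp (chain_state j (N %/ b)) (digit (N %% b))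
  else (f0 (digit N)).2.

(** The coordinates 0 and 1 are drawn together from the first digit. *)
Definition chain_path (x : measurableTypeR R) : paths n :=
  fun i => match i return coord_type n i with
    | 0 => (f0 (digit (leading b 1 x))).1
    | j.+1 => chain_state j (leading b j.+1 x)
    end.

Lemma measurable_chain_path : measurable_fun setT chain_path.
Proof.
apply: (@measurability _ _ (measurableTypeR R) (paths n) setT chain_path
  (@coord_events n)) => // _ [_ [i [a ->]] <-].
rewrite setTI; case: i a => [|i] a.
  rewrite (_ : _ @^-1` _ = [set x | (f0 (digit (leading b 1 x))).1 == a]).
    exact: (@measurable_leading R b 1 (fun N => (f0 (digit N)).1 == a) b_gt0).
  by apply/seteqP; split=> x /= /eqP.
rewrite (_ : _ @^-1` _ = [set x | chain_state i (leading b i.+1 x) == a]).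
  exact: (@measurable_leading R b i.+1 (fun N => chain_state i N == a) b_gt0).
by apply/seteqP; split=> x /= /eqP.
Qed.

HB.instance Definition _ :=
  isMeasurableFun.Build _ _ _ _ chain_path measurable_chain_path.

Definition chain_law : probability (paths n) R := distribution (@unif01 R) chain_path.

Definition chain_init (a : 'I_2 * L) : R := (\sum_t (f0 t == a))%N%:R / b%:R.
Definition chain_step (s s' : L) : R := (\sum_t (stp s t == s'))%N%:R / b%:R.

(** An event that depends only on the first k digits is measured by counting; the
    driving number lies in [0, 1[, which is why x may be assumed nonnegative. *)
Lemma chain_lawE (A : set (paths n)) k (B : pred nat) :
  (forall x : R, 0 <= x -> A (chain_path x) <-> B (leading b k x)) ->
  chain_law A = ((\sum_(0 <= N < b ^ k) B N)%N%:R / b%:R ^+ k)%:E.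
Proof.
move=> AB; rewrite -(unif01_leading R k B b_gt0) /chain_law /distribution /pushforward.
rewrite /unif01 /mrestr; congr lebesgue_measure.
apply/seteqP; split=> x /= [Ax]; rewrite in_itv /= => /andP[x0 x1];
  by split; rewrite ?in_itv /= ?x0 //; apply/AB.
Qed.

(** The next digit is independent of the past digits. This gives both the Markov
    property and the probabilities of histories. *)
Lemma chain_law_step (A : set (paths n)) i (B : pred nat) (a a' : L) :
  (forall x : R, 0 <= x -> A (chain_path x) <-> B (leading b i.+1 x)) ->
  (forall N, B N -> chain_state i N = a) ->
  chain_law (A `&` [set w : paths n | w i.+2 = a']) =
  (chain_law A * (chain_step a a')%:E)%E.
Proof.
move=> AB Ba; rewrite (chain_lawE AB).
rewrite (@chain_lawE _ i.+2
  (fun N => B (N %/ b)%N && (stp a (digit (N %% b)%N) == a'))); last first.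
  move=> x x0; rewrite /= AB //; rewrite leadingS //; split.
    by move=> [Bx <-]; rewrite Bx /= (Ba _ Bx).
  by case/andP=> Bx /eqP <-; rewrite (Ba _ Bx).
rewrite /= (sum_last_digit _ B (fun r => stp a (digit r) == a')) //.
rewrite (sum_digit (fun t => stp a t == a')) /chain_step.
have b0 : b%:R != 0 :> R by rewrite pnatr_eq0 -lt0n.
by rewrite -EFinM natrM [_ ^+ i.+2]exprSr invfM mulrACA.
Qed.

(** The past of the chain up to time i + 1, read off the leading digits. *)
Fixpoint history_test (y : paths n) (i N : nat) : bool :=
  if i is j.+1 then history_test y j (N %/ b) && (chain_state i N == y i.+1)
  else f0 (digit N) == (y 0%N, y 1%N).

Lemma historyE (y : paths n) i (x : R) : 0 <= x ->
  history i.+1 y (chain_path x) <-> history_test y i (leading b i.+1 x).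
Proof.
move=> x0; elim: i => [|i IH] /=.
  split=> [h|/eqP h].
    by move: (h 0%N isT) (h 1%N isT) => /= <- <-; rewrite -surjective_pairing.
  by case=> [|[|j]] // _ /=; rewrite h.
rewrite -/(chain_state i.+1 (leading b i.+2 x)) leadingS //; split.
  move=> h; apply/andP; split; last by apply/eqP; exact: (h i.+2).
  by apply/IH => j ji; apply: h; rewrite leqW.
case/andP => /IH h /eqP h2 j; rewrite leq_eqVlt => /orP[/eqP ->|]; last exact: h.
exact: h2.
Qed.

Lemma chain_history1 y : chain_law (history 1 y) = (chain_init (y 0%N, y 1%N))%:E.
Proof.
rewrite (chain_lawE (fun x x0 => historyE y 0 x0)) expr1 expn1.
by rewrite /= (sum_digit (fun t => f0 t == (y 0%N, y 1%N))).
Qed.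

Lemma history_test_last y i N : history_test y i N -> chain_state i N = y i.+1.
Proof. by case: i => [/eqP /= -> //|i /= /andP[_ /eqP]]. Qed.

Lemma history_coord y i :
  history i.+1 y = history i y `&` [set w : paths n | w i.+1 = y i.+1].
Proof.
apply/seteqP; split=> w.
  by move=> h; split=> [j ji|]; apply: h => //; rewrite leqW.
by case=> h h2 j; rewrite leq_eqVlt => /orP[/eqP -> //|]; exact: h.
Qed.

Lemma history0 (y : paths n) : history 0 y = [set w : paths n | w 0%N = y 0%N].
Proof.
apply/seteqP; split=> w; first by move=> /(_ 0%N isT).
by move=> h [|j].
Qed.

Lemma measurable_history (y : paths n) i : measurable (history i y).
Proof.
elim: i => [|i IH]; first by rewrite history0; exact: (@measurable_coord n 0).
by rewrite history_coord; apply: measurableI => //; exact: (@measurable_coord n i.+1).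
Qed.

Lemma chain_historyS y i :
  chain_law (history i.+2 y) =
  (chain_law (history i.+1 y) * (chain_step (y i.+1) (y i.+2))%:E)%E.
Proof.
rewrite history_coord; apply: (chain_law_step (B := history_test y i)).
  by move=> x; exact: historyE.
exact: history_test_last.
Qed.

(** Conditioning on the whole past and on the present state both give the
    transition probability, by [chain_law_step]. *)
Lemma chain_markov : markov_chain chain_law.
Proof.
move=> [|i] y.
  by rewrite history0.
move=> hpos; rewrite /cond_prob.
have cpos : (0 < chain_law [set w : paths n | w i.+1 = y i.+1])%E.
  apply: lt_le_trans hpos _; apply: le_measure; rewrite ?inE.
  - exact: measurable_history.
  - exact: (@measurable_coord n i.+1).
  - by move=> w /(_ i.+1 (leqnn _)).
have fE (A : set (paths n)) (B : pred nat) : (0 < chain_law A)%E ->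
  (forall x : R, 0 <= x -> A (chain_path x) <-> B (leading b i.+1 x)) ->
  (forall N, B N -> chain_state i N = y i.+1) ->
  fine (chain_law ([set w : paths n | w i.+2 = y i.+2] `&` A)) / fine (chain_law A) =
  chain_step (y i.+1) (y i.+2).
  move=> A0 AB Ba; rewrite setIC (chain_law_step _ AB Ba).
  move: A0; rewrite (chain_lawE AB) lte_fin -EFinM /= => A0.
  by rewrite mulrAC divff ?mul1r // gt_eqF.
rewrite (fE _ (history_test y i)) //; last 2 first.
- by move=> x; exact: historyE.
- exact: history_test_last.
rewrite (fE _ (fun N => chain_state i N == y i.+1)) //.
  by move=> x x0; split=> /eqP.
by move=> N /eqP.
Qed.

End Chain.

(** * The law of the walk *)

Section Law.
Variables (R : realType) (n m : nat).
Local Notation L := 'I_n.+1.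
Variable e : rel L.
Hypothesis e_biregular : biregular m.+1 e.
Local Notation wprob := (walk_prob R m.+1 e).
Local Notation sprob := (step_prob R m.+1 e).
Implicit Types (k : 'I_2) (a c d : L).

(** The joint law of k and c_1: the letter c is uniform, and k = 1 with
    probability c / (n + 1), so that distinct letters give distinct posteriors. *)
Definition prior k c : R := (if k == ord0 then (n.+1 - c)%N else c)%:R / n.+1%:R ^+ 2.

(** Every digit carries the randomness for c_1, for k given c_1, and for a step. *)
Definition noise := (L * L * 'I_m.+1)%type.

Definition draw (t : noise) : 'I_2 * L :=
  (if (t.1.2 < t.1.1)%N then ord_max else ord0, t.1.1).

(** All out-degrees are m + 1, so this is a uniform successor of s. *)
Definition advance (s : L) (t : noise) : L := nth ord0 (enum (e s)) t.2.

Definition walk_law := chain_law R (ord0, ord0, ord0) draw advance.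

Lemma chain_initE k c : chain_init R draw (k, c) = prior k c.
Proof.
have n0 : n.+1%:R != 0 :> R by rewrite pnatr_eq0.
have m0 : m.+1%:R != 0 :> R by rewrite pnatr_eq0.
have -> : chain_init R draw (k, c) =
   ((\sum_(r < n.+1) ((if (r < c)%N then ord_max else ord0) == k)) * m.+1)%N%:R /
     (n.+1 * n.+1 * m.+1)%N%:R.
  rewrite /chain_init !card_prod !card_ord sum_pair sum_pair; congr (_%:R / _).
  rewrite (bigD1 c) //= [X in (_ + X)%N]big1 ?addn0.
    rewrite big_distrl; apply: eq_bigr => r _ /=.
    under eq_bigr do rewrite /draw /= xpair_eqE eqxx andbT.
    by rewrite sum_nat_const card_ord mulnC.
  move=> a ac; rewrite big1 // => r _; rewrite big1 // => j _.
  by rewrite /draw /= xpair_eqE (negPf ac) andbF.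
have -> : (\sum_(r < n.+1) ((if (r < c)%N then ord_max else ord0) == k) =
    if k == ord0 then n.+1 - c else c)%N.
  have cn := ltn_ord c.
  have sum_lt : (\sum_(r < n.+1) (r < c) = c)%N.
    rewrite -[RHS](card_ord c) -sum1_card (big_ord_widen _ (fun=> 1%N) (ltnW cn)).
    by rewrite [RHS]big_mkcond; apply: eq_bigr => r _; case: ltnP.
  case: k => -[|[]] //= k2; last first.
    by rewrite -[RHS]sum_lt; apply: eq_bigr => r _; case: ifP.
  rewrite -[in RHS]sum_lt -[X in (X - _)%N]card_ord -sum1_card -sumnB; last by move=> r _; case: (_ < _)%N.
  by apply: eq_bigr => r _; case: ifP.
rewrite /prior !natrM expr2; set N := (if _ then _ else _).
by rewrite -!natrM; field; rewrite !nat1r n0 m0.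
Qed.

Lemma chain_stepE a c : chain_step R advance a c = sprob a c.
Proof.
have n0 : n.+1%:R != 0 :> R by rewrite pnatr_eq0.
have m0 : m.+1%:R != 0 :> R by rewrite pnatr_eq0.
have sz : size (enum (e a)) = m.+1.
  rewrite -cardE -sum1_card big_mkcond /=; case: e_biregular => /(_ a) <- _.
  by apply: eq_bigr => x _; rewrite unfold_in; case: (e a x).
have H : (\sum_(j < m.+1) (nth ord0 (enum (e a)) j == c) = e a c)%N.
  have -> : (e a c = (c \in enum (e a)) :> nat) by rewrite mem_enum.
  rewrite -(count_uniq_mem _ (enum_uniq _)) -sum1_count [RHS]big_mkcond [RHS](big_nth ord0).
  by rewrite sz big_mkord; apply: eq_bigr => j _ /=; case: (_ == _).
rewrite /chain_step /step_prob !card_prod !card_ord.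
rewrite sum_pair (eq_bigr (fun=> e a c : nat)); last by move=> p _; rewrite -H.
rewrite sum_nat_const card_prod !card_ord !natrM.
by field; rewrite !nat1r n0 m0.
Qed.

Lemma walk_law_history (y : paths n) i :
  walk_law (history i.+1 y) =
  (prior (y 0%N) (y 1%N) * wprob (y 1%N) (mkseq (fun j => y j.+2 : L) i))%:E.
Proof.
elim: i => [|i IH]; first by rewrite chain_history1 chain_initE mulr1.
rewrite chain_historyS IH chain_stepE mkseqS walk_prob_rcons -EFinM -mulrA.
congr EFin; congr (_ * (_ * sprob _ _)).
case: i {IH} => [|i] //; by rewrite mkseqS last_rcons.
Qed.

(** The path k, c_1, d_1, ..., c_l, d_l has the prior probability of (k, c_1) times
    the probability of a walk that starts in c_1. *)
Lemma walk_law_proj l (k : 'I_2) (c d : l.+1.-tuple L) :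
  walk_law (@Defs.proj n l.+1 @^-1` [set (k, c, d)]) =
  (prior k (thead c) * wprob (thead c) (interleave d (behead c)))%:E.
Proof.
pose s := interleave c d.
have sz : size s = l.+1.*2 by rewrite size_interleave !size_tuple.
pose y : paths n := fun i => match i return coord_type n i with
    | 0 => k | j.+1 => nth ord0 s j end.
have y_even (p : 'I_l.+1) : y p.*2.+1 = tnth c p :> L.
  have [/= -> _] := nth_interleave ord0 p (etrans (size_tuple c) (esym (size_tuple d))).
  by rewrite -tnth_nth.
have y_odd (p : 'I_l.+1) : y p.*2.+2 = tnth d p :> L.
  have [_ /= ->] := nth_interleave ord0 p (etrans (size_tuple c) (esym (size_tuple d))).
  by rewrite -tnth_nth.
have -> : @Defs.proj n l.+1 @^-1` [set (k, c, d)] = history l.*2.+2 y.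
  apply/seteqP; split=> w.
    move=> [wk wc wd] [_|j jl]; first exact: wk.
    have pl : (j./2 < l.+1)%N by rewrite -ltn_double; lia.
    rewrite -(odd_double_half j); case: (odd j).
      by rewrite add1n (y_odd (Ordinal pl)) -wd tnth_mktuple.
    by rewrite add0n (y_even (Ordinal pl)) -wc tnth_mktuple.
  move=> h /=; rewrite /Defs.proj; congr (_, _, _).
  - exact: (h 0%N).
  - apply: eq_from_tnth => p; rewrite tnth_mktuple -y_even h //.
    by rewrite ltnS (leq_trans (_ : _ <= l.*2)%N) // leq_double -ltnS.
  - apply: eq_from_tnth => p; rewrite tnth_mktuple -y_odd h //.
    by rewrite !ltnS leq_double -ltnS.
rewrite walk_law_history.
have cE : tval c = thead c :: behead c by rewrite [in LHS](tuple_eta c).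
have sE : s = thead c :: interleave d (behead c) by rewrite /s cE interleave_cons.
rewrite {1 2}/y sE [nth _ _ _]/=.
congr EFin; congr (_ * _); congr (wprob _ _); first by rewrite /y sE.
apply: (@eq_from_nth _ ord0) => [|j]; rewrite size_mkseq.
  by move: sz; rewrite sE /= doubleS => -[].
by move=> jl; rewrite nth_mkseq // /y sE.
Qed.

End Law.

(** * Values of bounded games *)

(** The bijection h translates between the pointed and the finite structure of
    the same type. *)
Lemma Rintegral_finite (R : realType) (T : pointedType) (F : finType) (h : F -> T)
    (P : probability (discrete T) R) (f : T -> R) : bijective h ->
  \int[P]_x f x = \sum_(a : F) f (h a) * fine (P [set h a]).
Proof.
move=> [h' hK h'K].
have mD (A : set (discrete T)) : measurable A by [].
have cover : \big[setU/set0]_(a : F) [set h a] = [set: discrete T].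
  apply/seteqP; split=> // x _; rewrite -[x]h'K (bigD1 (h' x)) //=; by left.
have h_inj : injective h := can_inj hK.
rewrite /Rintegral -cover integral_bigsetU_EFin //; first last.
- apply/trivIsetP => i j _ _ ij; rewrite -subset0 => x [/= xi xj].
  have /h_inj ijE : h i = h j by rewrite -xi.
  by rewrite ijE eqxx in ij.
- exact: index_enum_uniq.
have intE a : (\int[P]_(x in [set h a]) (f x)%:E = (f (h a) * fine (P [set h a]))%:E)%E.
  rewrite (eq_integral (cst (f (h a))%:E)); last by move=> x; rewrite inE => ->.
  by rewrite integral_cst // EFinM fineK // fin_num_measure.
by under eq_bigr do rewrite intE; rewrite sumEFin.
Qed.

Section Saddle.
Variables (R : realType) (A B : Type) (E : A -> B -> R) (SA : set A) (SB : set B).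
Hypotheses (SA0 : SA !=set0) (SB0 : SB !=set0).
Hypothesis E_bounded : forall a b, SA a -> SB b -> -1 <= E a b <= 1.

Let lower a : R := inf [set E a b | b in SB].
Let upper b : R := sup [set E a b | a in SA].

Lemma lower_le a b : SA a -> SB b -> lower a <= E a b.
Proof.
move=> Aa Bb; apply: ge_inf; last by exists b.
by exists (-1) => _ [b' Bb' <-]; case/andP: (E_bounded Aa Bb').
Qed.

Lemma le_lower a v : (forall b, SB b -> v <= E a b) -> v <= lower a.
Proof.
move=> h; apply: lb_le_inf; last by move=> _ [b Bb <-]; exact: h.
by case: SB0 => b Bb; exists (E a b), b.
Qed.

Lemma le_upper a b : SA a -> SB b -> E a b <= upper b.
Proof.
move=> Aa Bb; apply: ub_le_sup; last by exists a.
by exists 1 => _ [a' Aa' <-]; case/andP: (E_bounded Aa' Bb).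
Qed.

Lemma upper_le b v : (forall a, SA a -> E a b <= v) -> upper b <= v.
Proof.
move=> h; apply: ge_sup; last by move=> _ [a Aa <-]; exact: h.
by case: SA0 => a Aa; exists (E a b), a.
Qed.

Lemma maxmin_ge a v : SA a -> (forall b, SB b -> v <= E a b) ->
  v <= sup [set lower a | a in SA].
Proof.
move=> Aa h; apply: le_trans (le_lower h) _; apply: ub_le_sup; last by exists a.
exists 1 => _ [a' Aa' <-]; case: SB0 => b Bb.
by apply: le_trans (lower_le Aa' Bb) _; case/andP: (E_bounded Aa' Bb).
Qed.

Lemma maxmin_le b v : SB b -> (forall a, SA a -> E a b <= v) ->
  sup [set lower a | a in SA] <= v.
Proof.
move=> Bb h; apply: ge_sup; first by case: SA0 => a Aa; exists (lower a), a.
by move=> _ [a Aa <-]; exact: le_trans (lower_le Aa Bb) (h _ Aa).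
Qed.

Lemma minmax_le b v : SB b -> (forall a, SA a -> E a b <= v) ->
  inf [set upper b | b in SB] <= v.
Proof.
move=> Bb h; apply: le_trans (upper_le h); apply: ge_inf; last by exists b.
exists (-1) => _ [b' Bb' <-]; case: SA0 => a Aa.
by apply: le_trans (le_upper Aa Bb'); case/andP: (E_bounded Aa Bb').
Qed.

Lemma minmax_ge a v : SA a -> (forall b, SB b -> v <= E a b) ->
  v <= inf [set upper b | b in SB].
Proof.
move=> Aa h; apply: lb_le_inf; first by case: SB0 => b Bb; exists (upper b), b.
by move=> _ [b Bb <-]; exact: le_trans (h _ Bb) (le_upper Aa Bb).
Qed.

End Saddle.

Section PureStrategies.
Variables (R : realType) (S : Type) (I : finType) (f : S -> I).

Definition pure (x : S) (i : I) : R := (i == f x)%:R.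

Lemma pure_strategy : @strategies R S I pure.
Proof.
move=> x; split=> [i|]; first exact: ler0n.
by rewrite (bigD1 (f x)) //= /pure eqxx big1 ?addr0 // => i /negPf ->.
Qed.

Lemma sum_pure x (F : I -> R) : \sum_i pure x i * F i = F (f x).
Proof.
rewrite (bigD1 (f x)) //= big1 ?addr0 /pure ?eqxx ?mul1r // => i /negPf ->.
by rewrite mul0r.
Qed.

End PureStrategies.

Section Value.
Variables (R : realType) (S1 S2 : pcountType) (u : infostruct R S1 S2).
Variables (I J : finType) (i0 : I) (j0 : J) (g : 'I_2 -> I -> J -> R).

Lemma strategies_neq0 (S : Type) (T : finType) (t : T) : @strategies R S T !=set0.
Proof. by exists (pure R (fun=> t)); exact: pure_strategy. Qed.

Hypothesis payoff_bounded : forall sigma tau,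
  @strategies R S1 I sigma -> @strategies R S2 J tau ->
  -1 <= expected_payoff u g sigma tau <= 1.

Let SI := strategies_neq0 S1 i0.
Let SJ := strategies_neq0 S2 j0.

Lemma game_val_saddle sigma tau v :
  @strategies R S1 I sigma -> @strategies R S2 J tau ->
  (forall tau', @strategies R S2 J tau' -> v <= expected_payoff u g sigma tau') ->
  (forall sigma', @strategies R S1 I sigma' -> expected_payoff u g sigma' tau <= v) ->
  game_val u g = v.
Proof.
move=> Ss St hs ht; apply: xget_unique.
  split; apply/eqP; rewrite eq_le.
    by rewrite (maxmin_ge SJ payoff_bounded Ss hs) (maxmin_le SI payoff_bounded St ht).
  by rewrite (minmax_ge SJ payoff_bounded Ss hs) (minmax_le SI payoff_bounded St ht).
move=> _ [-> _]; apply/eqP; rewrite eq_le.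
by rewrite (maxmin_ge SJ payoff_bounded Ss hs) (maxmin_le SI payoff_bounded St ht).
Qed.

(** A value of the game is at most the supremum against tau; otherwise [game_val]
    is 0, whence the assumption 0 <= v. *)
Lemma game_val_le tau v : 0 <= v -> @strategies R S2 J tau ->
  (forall sigma', @strategies R S1 I sigma' -> expected_payoff u g sigma' tau <= v) ->
  game_val u g <= v.
Proof.
move=> v0 St ht; rewrite /game_val; case: xgetP => [_ -> [-> _]|//].
exact: (maxmin_le SI payoff_bounded St ht).
Qed.

Lemma norm_game_val_le1 : `|game_val u g| <= 1.
Proof.
rewrite /game_val; case: xgetP => [_ -> [-> _]|_]; last by rewrite normr0.
have [[sigma Ss] [tau St]] := (SI, SJ); rewrite ler_norml.
rewrite (maxmin_ge SJ payoff_bounded Ss) ?(maxmin_le SI payoff_bounded St) //.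
  by move=> sigma' Ss'; case/andP: (payoff_bounded Ss' St).
by move=> tau' St'; case/andP: (payoff_bounded Ss St').
Qed.

End Value.

(** * The reporting game *)

Section Game.
Variables (R : realType) (n m : nat).
Local Notation L := 'I_n.+1.
Variable e : rel L.
Hypotheses (n_gt0 : (0 < n)%N) (e_biregular : biregular m.+1 e) (e_sep : separating e).
Local Notation wprob := (walk_prob R m.+1 e).
Local Notation sprob := (step_prob R m.+1 e).
Local Notation pri := (prior R).
Local Notation P := (walk_law R m e).
Implicit Types (k : 'I_2) (a b : L) (c d i j : seq L).

Let L1 : (1 < #|{: L}|)%N. Proof. by rewrite card_ord ltnS. Qed.

(** The probability that the chain starts with k and the signals c and d. *)
Definition walk_mass k c d : R :=
  pri k (head ord0 c) * wprob (head ord0 c) (interleave d (behead c)).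

Lemma prior_ge0 k a : 0 <= pri k a.
Proof. by rewrite divr_ge0. Qed.

Lemma mass_ge0 k c d : 0 <= walk_mass k c d.
Proof. by rewrite mulr_ge0 ?prior_ge0 ?walk_prob_ge0. Qed.

Lemma sum_ord2 (F : 'I_2 -> R) : \sum_k F k = F ord0 + F ord_max.
Proof. by rewrite big_ord_recl big_ord1; congr (_ + F _); apply: val_inj. Qed.

Lemma sum_prior a : \sum_k pri k a = n.+1%:R^-1.
Proof.
rewrite sum_ord2 /prior /= natrB ?(ltnW (ltn_ord a)) //.
have n0 : 1 + n%:R != 0 :> R by rewrite nat1r pnatr_eq0.
by field.
Qed.

Lemma exchange_seqsum h h' (F : seq L -> seq L -> R) :
  seqsum h (fun s => seqsum h' (F s)) = seqsum h' (fun t => seqsum h (F^~ t)).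
Proof. exact: exchange_big. Qed.

(** The two players alternate, so the induction on the total length exchanges the
    two sums at each step. *)
Lemma walks_total h h' a : (h' <= h <= h'.+1)%N ->
  seqsum h (fun ds => seqsum h' (fun cs => wprob a (interleave ds cs))) = 1.
Proof.
elim: {h h'}(h + h')%N {-2}h {-2}h' (leqnn (h + h')) a => [|N IH] [|h] h' hN a hh.
- by rewrite (_ : h' = 0%N) ?seqsum0 //; lia.
- lia.
- by rewrite (_ : h' = 0%N) ?seqsum0 //; lia.
rewrite seqsumS -[RHS](sum_step_prob R e_biregular e_sep L1 a); apply: eq_bigr => d _.
rewrite exchange_seqsum -[RHS]mulr1 -(IH h' h _ d); [|lia|lia].
rewrite -seqsumZ; apply: eq_seqsum => cs _; rewrite -seqsumZ; apply: eq_seqsum => ds _.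
by rewrite interleave_cons.
Qed.

(** What depends only on k and c_1 has the same expectation for all lengths p; in
    particular truthful scores do. *)
Lemma mass_total p (F : 'I_2 -> L -> R) :
  \sum_k seqsum p.+1 (fun c => seqsum p.+1 (fun d => walk_mass k c d * F k (head ord0 c))) =
  \sum_k \sum_a pri k a * F k a.
Proof.
apply: eq_bigr => k _; rewrite seqsumS; apply: eq_bigr => a _ /=.
rewrite exchange_seqsum -[RHS]mulr1 -(@walks_total p.+1 p a); last by lia.
rewrite -seqsumZ; apply: eq_seqsum => ds _; rewrite -seqsumZ; apply: eq_seqsum => cs _.
by rewrite /walk_mass /= mulrAC.
Qed.

Lemma expected_payoffE p (I J : finType) (g : 'I_2 -> I -> J -> R) sigma tau :
  expected_payoff (marginal P p.+1) g sigma tau =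
  \sum_k \sum_(c : p.+1.-tuple L) \sum_(d : p.+1.-tuple L)
     walk_mass k c d * \sum_i \sum_j sigma c i * tau d j * g k i j.
Proof.
rewrite /expected_payoff.
rewrite (@Rintegral_finite _ _ ('I_2 * p.+1.-tuple L * p.+1.-tuple L)%type idfun); last by exists idfun.
rewrite pair_bigA pair_bigA /=; apply: eq_bigr => -[[k c] d] _ /=.
rewrite mulrC; congr (_ * _).
have hE (t : p.+1.-tuple L) : head ord0 t = thead t by rewrite [in LHS](tuple_eta t).
rewrite /walk_mass !hE -[RHS]/(fine (_ * _)%:E) -walk_law_proj //.
Qed.

Lemma prior_sum1 : \sum_k \sum_(a : L) pri k a = 1.
Proof.
rewrite exchange_big /=; under eq_bigr => a _ do rewrite sum_prior.
by rewrite sumr_const card_ord -[RHS](@mulfV _ n.+1%:R) ?pnatr_eq0 // mulr_natl.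
Qed.

Lemma mass_sum1 p :
  \sum_k seqsum p.+1 (fun c => seqsum p.+1 (fun d => walk_mass k c d)) = 1.
Proof.
have := mass_total p (fun _ _ => 1).
under eq_bigr => k _ do under eq_seqsum => c _ do under eq_seqsum => d _ do rewrite mulr1.
move=> ->; rewrite -[RHS]prior_sum1.
by apply: eq_bigr => k _; apply: eq_bigr => a _; rewrite mulr1.
Qed.

Lemma expected_payoff_bounded p (I J : finType) (g : 'I_2 -> I -> J -> R) sigma tau :
  is_payoff g -> @strategies R _ I sigma -> @strategies R _ J tau ->
  -1 <= expected_payoff (marginal P p.+1) g sigma tau <= 1.
Proof.
move=> g1 Ss St; rewrite expected_payoffE -ler_norml -[leRHS](mass_sum1 p).
apply: le_trans (ler_norm_sum _ _ _) _; apply: ler_sum => k _.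
apply: le_trans (ler_norm_sum _ _ _) _; apply: ler_sum => c _.
apply: le_trans (ler_norm_sum _ _ _) _; apply: ler_sum => d _.
rewrite normrM ger0_norm ?mass_ge0 // -[leRHS]mulr1; apply: ler_wpM2l.
  exact: mass_ge0.
have [s0 <-] := Ss c; have [t0 t1] := St d.
apply: le_trans (ler_norm_sum _ _ _) _; apply: ler_sum => i _.
apply: le_trans (ler_norm_sum _ _ _) _.
rewrite -[leRHS]mulr1 -t1 big_distrr; apply: ler_sum => j _ /=.
rewrite !normrM (ger0_norm (s0 i)) (ger0_norm (t0 j)).
rewrite -[leRHS]mulr1; apply: ler_wpM2l; first by rewrite mulr_ge0.
by rewrite ler_norml.
Qed.

Definition posterior a : R := a%:R / n.+1%:R.

(** A quadratic scoring rule: its conditional expectation given c_1 = c is largest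
    when a = c. The constants keep it in [1/4, 3/4], away from 0 and with room for
    the stake. *)
Definition score k a : R := 3%:R / 4%:R - (k%:R - posterior a) ^+ 2 / 2%:R.

(** Half of the smallest loss in expected score for a wrong first letter, see
    [score_truthful]. *)
Definition stake : R := (4%:R * n.+1%:R ^+ 2)^-1.

Definition report_payoff k i j : R :=
  score k (head ord0 i) + stake * blame e 1 (head ord0 i) (interleave j (behead i)).

Let nR : 1 <= n.+1%:R :> R. Proof. by rewrite ler1n. Qed.
Let nR0 : n.+1%:R != 0 :> R. Proof. by rewrite pnatr_eq0. Qed.

Lemma stake_gt0 : 0 < stake.
Proof. by rewrite invr_gt0 mulr_gt0 ?exprn_gt0 ?ltr0n. Qed.

Lemma stake_le : stake <= 4%:R^-1.
Proof.
rewrite lef_pV2 ?posrE ?mulr_gt0 ?exprn_gt0 ?ltr0n // -[leLHS]mulr1.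
by rewrite ler_wpM2l // exprn_ege1.
Qed.

Lemma posterior_itv a : 0 <= posterior a <= 1.
Proof.
rewrite divr_ge0 //= ler_pdivrMr ?ltr0n // mul1r ler_nat.
exact: ltnW (ltn_ord a).
Qed.

Lemma score_itv k a : 4%:R^-1 <= score k a <= 3%:R / 4%:R.
Proof.
have /andP[p0 p1] := posterior_itv a.
have k01 : (k%:R = 0 :> R) \/ (k%:R = 1 :> R).
  by case: k => -[|[]] // ?; [left|right].
have h : 0 <= (k%:R - posterior a) ^+ 2 <= 1.
  rewrite sqr_ge0 /= -ler_sqrt ?ltr01 // sqrtr_sqr sqrtr1.
  by case: k01 => ->; rewrite ler_norml; lra.
by rewrite /score; move: h; set z := _ ^+ 2; lra.
Qed.

Lemma report_payoff_bounded k i j : -1 <= report_payoff k i j <= 1.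
Proof.
have := score_itv k (head ord0 i); have := stake_gt0; have := stake_le.
have := norm_blame e (1 : R) (head ord0 i) (interleave j (behead i)).
rewrite /report_payoff normr1; set b := blame _ _ _ _; set s := score _ _ => b1 s1 s2 h.
have : `|stake * b| <= 4%:R^-1.
  rewrite normrM (ger0_norm (ltW s2)) -[leRHS]mulr1.
  by apply: ler_pM => //; exact: ltW.
by rewrite ler_norml; lra.
Qed.

(** The loss in score is (posterior a - posterior b) ^ 2 / 2, and distinct
    posteriors differ by at least 1 / (n + 1). *)
Lemma score_truthful a b : a != b ->
  \sum_k pri k a * score k b <= \sum_k pri k a * (score k a - 2%:R * stake).
Proof.
move=> ab.
have ab1 : 1 <= (a%:R - b%:R : R) ^+ 2.
  have natB (x y : nat) : (x < y)%N -> 1 <= (y%:R - x%:R : R) ^+ 2.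
    by move=> xy; rewrite -natrB ?(ltnW xy) // exprn_ege1 // ler1n subn_gt0.
  by case: (ltngtP a b) => [/natB|/natB|/val_inj/eqP]; rewrite ?(negPf ab) // -sqrrN opprB.
have -> : \sum_k pri k a * (score k a - 2%:R * stake) =
   \sum_k pri k a * score k b + ((a%:R - b%:R : R) ^+ 2 - 1) / (2%:R * n.+1%:R ^+ 3).
  rewrite !sum_ord2 /prior /score /posterior /stake /= natrB ?(ltnW (ltn_ord a)) //.
  by field; rewrite nat1r.
by rewrite lerDl divr_ge0 ?subr_ge0 // mulr_ge0 ?exprn_ge0.
Qed.

(** Player 2 announces his first q letters truthfully; player 1 observes c and
    announces i. A wrong first letter costs at least 2 stakes in score and brings at
    most one stake of blame; otherwise [truthful_gain] applies. *)
Lemma player1_deviation p q (kappa : R) c i : size c = p.+1 ->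
  kappa = 0 \/ [/\ kappa = m.+1%:R^-1, (p < q)%N & (p < size (behead i))%N] ->
  \sum_k seqsum p.+1 (fun d => walk_mass k c d * report_payoff k i (take q d)) <=
  \sum_k seqsum p.+1 (fun d => walk_mass k c d * (score k (head ord0 c) - stake * kappa)).
Proof.
case: c => [|a cs] //= [szc] hk.
pose T := seqsum p.+1 (fun d => wprob a (interleave d cs)).
pose b := head ord0 i.
pose G := seqsum p.+1 (fun d => wprob a (interleave d cs) *
                                blame e 1 b (interleave (take q d) (behead i))).
have T0 : 0 <= T by apply: seqsum_ge0 => d; exact: walk_prob_ge0.
have s0 := stake_gt0.
have -> : \sum_k seqsum p.+1 (fun d =>
      walk_mass k (a :: cs) d * report_payoff k i (take q d)) =
    (\sum_k pri k a * score k b) * T + (\sum_k pri k a) * (stake * G).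
  rewrite !big_distrl -big_split; apply: eq_bigr => k _ /=.
  rewrite /T /G -!seqsumZ -seqsumD; apply: eq_seqsum => d _.
  by rewrite /walk_mass /report_payoff /=; ring.
have -> : \sum_k seqsum p.+1 (fun d =>
      walk_mass k (a :: cs) d * (score k a - stake * kappa)) =
    (\sum_k pri k a * score k a) * T + (\sum_k pri k a) * (- (stake * kappa) * T).
  rewrite !big_distrl -big_split; apply: eq_bigr => k _ /=.
  rewrite /T -!seqsumZ -seqsumD; apply: eq_seqsum => d _.
  by rewrite /walk_mass /=; ring.
have P0 : 0 <= \sum_k pri k a by apply: sumr_ge0 => k _; exact: prior_ge0.
have [ab|ab] := eqVneq a b.
  rewrite -ab lerD2l ler_wpM2l // -mulrN -mulrA ler_pM2l //.
  rewrite /G -ab; apply: truthful_gain => //; first by rewrite szc.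
  by case: hk => [->|[-> pq pi]]; [left|right; split; rewrite // szc].
have GT : G <= T.
  apply: ler_seqsum => d _; rewrite -[leRHS]mulr1 ler_wpM2l ?walk_prob_ge0 //.
  exact: blame1_le.
have k1 : kappa <= 1.
  by case: hk => [->|[-> _ _]] //; rewrite invf_le1 ?ler1n ?ltr0n.
apply: le_trans (lerD (ler_wpM2r T0 (score_truthful ab)) (lexx _)) _.
under eq_bigr do rewrite mulrBr; rewrite sumrB -big_distrl /=.
rewrite -subr_ge0.
rewrite [leRHS](_ : _ = (\sum_k pri k a) * (stake * ((T - G) + (1 - kappa) * T)));
  last by ring.
by rewrite !mulr_ge0 ?(ltW s0) // addr_ge0 ?mulr_ge0 ?subr_ge0.
Qed.

(** Player 1 announces his first q + 1 letters truthfully; player 2 observes d and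
    announces j. The letter c_1 is hidden from player 2 and uniform among those that
    lead to d_1, so a false first letter is settled by [lie_first]. After a truthful
    one, player 2 is in the situation of [truthful_gain]. *)
Lemma player2_deviation p q d j : size d = p.+1 -> (0 < size j)%N ->
  \sum_k seqsum p.+1 (fun c => walk_mass k c d * score k (head ord0 c)) <=
  \sum_k seqsum p.+1 (fun c => walk_mass k c d * report_payoff k (take q.+1 c) j).
Proof.
case: d => [|d1 ds] // [szd]; case: j => [|j1 js] // _.
have s0 := stake_gt0.
pose w a := sprob a d1.
pose T := seqsum p (fun cs => wprob d1 (interleave cs ds)).
pose G a := seqsum p (fun cs => wprob d1 (interleave cs ds) *
  (if e a j1 then - blame e 1 j1 (interleave (take q cs) js) else 1)).
have T0 : 0 <= T by apply: seqsum_ge0 => cs; exact: walk_prob_ge0.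
have -> : \sum_k seqsum p.+1 (fun c =>
    walk_mass k c (d1 :: ds) * report_payoff k (take q.+1 c) (j1 :: js)) =
  \sum_k seqsum p.+1 (fun c => walk_mass k c (d1 :: ds) * score k (head ord0 c)) +
  stake / n.+1%:R * \sum_a w a * G a.
  rewrite big_distrr /=.
  under [X in _ + X]eq_bigr => a _ do rewrite -mulrA -(sum_prior a) mulrCA big_distrl /=.
  rewrite [X in _ + X]exchange_big -big_split; apply: eq_bigr => k _ /=.
  rewrite !seqsumS -big_split; apply: eq_bigr => a _ /=.
  rewrite -!seqsumZ -seqsumD; apply: eq_seqsum => cs _.
  rewrite /walk_mass /report_payoff !interleave_cons /= blameN.
  by rewrite /w; case: (e a j1); ring.
rewrite lerDl mulr_ge0 ?divr_ge0 ?(ltW s0) //.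
rewrite -oppr_le0 -sumrN.
have [jd|jd] := eqVneq j1 d1.
  apply: sumr_le0 => a _; rewrite /w /step_prob -mulrN.
  have [ad|ad] := boolP (e a d1); last by rewrite /= !mul0r.
  apply: mulr_ge0_le0; first by rewrite divr_ge0.
  rewrite /G jd ad -mulN1r -seqsumZ.
  under eq_seqsum => cs _ do rewrite mulN1r mulrN opprK.
  have := @truthful_gain R L m.+1 e e_biregular e_sep L1 0 p q d1 ds js.
  by rewrite oppr0 mul0r; apply; [rewrite szd | left].
apply: (@le_trans _ _ ((\sum_a sprob a d1 * (if e a j1 then 1 else -1)) * T)).
  rewrite big_distrl; apply: ler_sum => a _ /=; rewrite -mulrN -mulrA.
  apply: ler_wpM2l; first exact: step_prob_ge0.
  rewrite -mulN1r /G /T -!seqsumZ; apply: ler_seqsum => cs _.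
  rewrite mulN1r -mulrN mulrC ler_wpM2r ?walk_prob_ge0 //.
  by case: ifP => // _; rewrite opprK; exact: blame1_le.
by apply: mulr_le0_ge0 => //; apply: lie_first.
Qed.

End Game.

(** * Separation of the information structures *)

Section Separation.
Variables (R : realType) (n m : nat).
Local Notation L := 'I_n.+1.

Definition cut p q (s : p.-tuple L) : q.-tuple L := [tuple nth ord0 s x | x < q].

Lemma val_cut p q (s : p.-tuple L) : (q <= p)%N -> tval (cut q s) = take q s.
Proof.
move=> qp; apply: (@eq_from_nth _ ord0) => [|x].
  by rewrite size_tuple size_takel // size_tuple.
rewrite size_tuple => xq; rewrite nth_take //.
by rewrite -[x]/(val (Ordinal xq)) -tnth_nth tnth_mktuple.
Qed.

Definition truthful p q : p.-tuple L -> q.-tuple L -> R := pure R (@cut p q).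

Variable e : rel L.
Hypotheses (n_gt0 : (0 < n)%N) (e_biregular : biregular m.+1 e) (e_sep : separating e).

Local Notation P := (walk_law R m e).
Local Notation bet := (stake R n).

(** Player 1 announces one letter more than player 2, and one letter more than he
    knows if each player has received q + 1 signals. *)
Definition report_game q (k : 'I_2) (i : q.+2.-tuple L) (j : q.+1.-tuple L) : R :=
  report_payoff R e k i j.

Definition truthful_val : R := \sum_k \sum_(a : L) prior R k a * score R k a.

Lemma report_game_payoff q : is_payoff (@report_game q).
Proof. by move=> k i j; exact: report_payoff_bounded. Qed.

(** By linearity it is enough to bound the payoff of each announcement after each
    sequence of signals, which is [player1_deviation]. *)
Lemma player2_truthful p q (kappa : R) sigma : (q <= p)%N ->
  kappa = 0 \/ (kappa = m.+1%:R^-1 /\ p = q) -> @strategies R _ _ sigma ->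
  expected_payoff (marginal P p.+1) (@report_game q) sigma (@truthful p.+1 q.+1) <=
  truthful_val - bet * kappa.
Proof.
move=> qp hk Ss; rewrite expected_payoffE //.
have -> : truthful_val - bet * kappa =
    \sum_(c : p.+1.-tuple L) \sum_k seqsum p.+1 (fun d =>
        walk_mass R m e k c d * (score R k (head ord0 c) - bet * kappa)).
  rewrite exchange_big.
  apply: etrans _ (esym (mass_total n_gt0 e_biregular e_sep p
    (fun k a => score R k a - bet * kappa))).
  under [RHS]eq_bigr do under eq_bigr do rewrite mulrBr.
  under [RHS]eq_bigr do rewrite sumrB -big_distrl.
  by rewrite sumrB -big_distrl prior_sum1 /= mul1r.
rewrite exchange_big; apply: ler_sum => c _ /=.
have [s0 s1] := Ss c.
rewrite -[leRHS]mul1r -s1 big_distrl /=.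
have -> : \sum_k \sum_(d : p.+1.-tuple L) walk_mass R m e k c d *
    (\sum_i \sum_j sigma c i * truthful d j * report_game k i j) =
  \sum_i sigma c i * \sum_k seqsum p.+1 (fun d =>
    walk_mass R m e k c d * report_payoff R e k i (take q.+1 d)).
  under [RHS]eq_bigr do rewrite big_distrr /=.
  rewrite [RHS]exchange_big; apply: eq_bigr => k _ /=.
  under [RHS]eq_bigr do rewrite big_distrr /=.
  rewrite [RHS]exchange_big; apply: eq_bigr => d _ /=.
  rewrite big_distrr; apply: eq_bigr => i _ /=.
  under eq_bigr do rewrite -mulrA.
  rewrite -big_distrr /= sum_pure /report_game val_cut // mulrCA //.
apply: ler_sum => i _; apply: ler_wpM2l => //.
apply: player1_deviation => //; first by rewrite size_tuple.
case: hk => [->|[-> ->]]; [by left|right; split=> //].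
by rewrite size_behead size_tuple.
Qed.

Lemma player1_truthful p q tau : (q < p)%N -> @strategies R _ _ tau ->
  truthful_val <=
  expected_payoff (marginal P p.+1) (@report_game q) (@truthful p.+1 q.+2) tau.
Proof.
move=> qp St; rewrite expected_payoffE //.
have -> : truthful_val =
    \sum_(d : p.+1.-tuple L) \sum_k seqsum p.+1 (fun c =>
        walk_mass R m e k c d * score R k (head ord0 c)).
  rewrite exchange_big /truthful_val.
  rewrite -(mass_total n_gt0 e_biregular e_sep p (fun k a => score R k a)).
  by apply: eq_bigr => k _; exact: exchange_seqsum.
have -> : \sum_k \sum_(c : p.+1.-tuple L) \sum_(d : p.+1.-tuple L)
    walk_mass R m e k c d *
    (\sum_i \sum_j truthful c i * tau d j * report_game k i j) =
  \sum_(d : p.+1.-tuple L) \sum_j tau d j * \sum_k seqsum p.+1 (fun c =>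
    walk_mass R m e k c d * report_payoff R e k (take q.+2 c) j).
  under [RHS]eq_bigr do under eq_bigr do rewrite big_distrr /=.
  under [RHS]eq_bigr do rewrite exchange_big /=.
  rewrite [RHS]exchange_big; apply: eq_bigr => k _ /=.
  rewrite exchange_big; apply: eq_bigr => d _ /=.
  under [RHS]eq_bigr do rewrite big_distrr /=.
  rewrite [RHS]exchange_big; apply: eq_bigr => c _ /=.
  rewrite exchange_big big_distrr; apply: eq_bigr => j _ /=.
  under eq_bigr do rewrite -mulrA.
  by rewrite sum_pure /report_game val_cut // mulrCA.
apply: ler_sum => d _.
have [t0 t1] := St d.
rewrite -[leLHS]mul1r -t1 big_distrl /=.
apply: ler_sum => j _; apply: ler_wpM2l => //.
by apply: player2_deviation => //; rewrite size_tuple.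
Qed.

Lemma truthful_val_ge : m.+1%:R^-1 * bet <= truthful_val.
Proof.
have s0 := stake_gt0 R n.
apply: (@le_trans _ _ 4%:R^-1).
  apply: le_trans (stake_le R n); rewrite ger_pMl //.
  by rewrite invf_le1 ?ler1n ?ltr0n.
rewrite -[leLHS]mul1r -[X in X * _](prior_sum1 R n) big_distrl; apply: ler_sum => k _ /=.
rewrite big_distrl; apply: ler_sum => a _ /=; apply: ler_wpM2l; first exact: prior_ge0.
by case/andP: (score_itv R k a).
Qed.

(** With p > l, truthful announcements form a saddle point in u^(p+1). In u^(l+1)
    player 1 has to guess his last letter. *)
Lemma report_game_gap l p : (l < p)%N ->
  m.+1%:R^-1 * bet <=
  `|game_val (marginal P l.+1) (@report_game l) -
    game_val (marginal P p.+1) (@report_game l)|.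
Proof.
move=> lp.
have bnd r : forall sigma tau, @strategies R _ _ sigma -> @strategies R _ _ tau ->
    -1 <= expected_payoff (marginal P r.+1) (@report_game l) sigma tau <= 1.
  by move=> sigma tau; apply: expected_payoff_bounded => //; exact: report_game_payoff.
have i0 : l.+2.-tuple L := [tuple ord0 | _ < l.+2].
have j0 : l.+1.-tuple L := [tuple ord0 | _ < l.+1].
have -> : game_val (marginal P p.+1) (@report_game l) = truthful_val.
  apply: (game_val_saddle i0 j0 (@bnd p) (pure_strategy R (@cut p.+1 l.+2))
    (pure_strategy R (@cut p.+1 l.+1))).
    by move=> tau St; apply: player1_truthful.
  move=> sigma Ss; rewrite -[leRHS]subr0 -(mulr0 bet).
  by apply: player2_truthful => //; [exact: ltnW|left].
have : game_val (marginal P l.+1) (@report_game l) <= truthful_val - bet * m.+1%:R^-1.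
  apply: (game_val_le i0 (@bnd l) _ (pure_strategy R (@cut l.+1 l.+1))).
    by rewrite subr_ge0 mulrC truthful_val_ge.
  by move=> sigma Ss; apply: player2_truthful => //; right.
move=> h; rewrite distrC; apply: le_trans (ler_norm _).
by rewrite mulrC lerBrDr addrC -lerBrDr.
Qed.

(** Values lie in [-1, 1], so the distance is the supremum of a bounded set, which
    contains the gap of the reporting game. *)
Lemma value_dist_ge l p : (l < p)%N ->
  m.+1%:R^-1 * bet <= value_dist (marginal P l.+1) (marginal P p.+1) /\
  m.+1%:R^-1 * bet <= value_dist (marginal P p.+1) (marginal P l.+1).
Proof.
move=> lp.
have val1 r (I J : finType) (i0 : I) (j0 : J) (g : 'I_2 -> I -> J -> R) :
    is_payoff g -> `|game_val (marginal P r.+1) g| <= 1.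
  move=> gP; apply: norm_game_val_le1 => // sigma tau; exact: expected_payoff_bounded.
have ubd r s : has_ubound [set x | exists (I J : finType) (i0 : I) (j0 : J)
    (g : 'I_2 -> I -> J -> R), is_payoff g /\
    x = `|game_val (marginal P r.+1) g - game_val (marginal P s.+1) g|].
  exists 2 => _ [I [J [i0 [j0 [g [gP ->]]]]]].
  by rewrite (le_trans (ler_normB _ _)) // lerD ?val1.
have i0 : l.+2.-tuple L := [tuple ord0 | _ < l.+2].
have j0 : l.+1.-tuple L := [tuple ord0 | _ < l.+1].
split; apply: le_trans (report_game_gap lp) _; apply: ub_le_sup => //.
  by exists _, _, i0, j0, (@report_game l); split => //; exact: report_game_payoff.
exists _, _, i0, j0, (@report_game l); split; first exact: report_game_payoff.
by rewrite distrC.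
Qed.

End Separation.

Theorem theorem19 (R : realType) :
  exists (eps : R) (n : nat) (mu : probability (paths n) R),
    [/\ 0 < eps, ~~ odd n.+1, markov_chain mu &
        forall l p : nat, (0 < l)%N -> (0 < p)%N -> p <> l ->
          eps < value_dist (marginal mu l) (marginal mu p)].
Proof.
have [n [m [e [n0 n_even e_bireg e_sep]]]] := separating_walk.
have m0 : (0 < m)%N by apply: (degree_gt0 e_bireg e_sep); rewrite card_ord ltnS.
case: m m0 e_bireg => // m _ e_bireg.
have s0 : 0 < stake R n := stake_gt0 R n.
exists (m.+1%:R^-1 * stake R n / 2), n, (walk_law R m e); split=> //.
- by rewrite divr_gt0 // mulr_gt0 // invr_gt0.
- exact: chain_markov.
move=> [//|l] [//|p] _ _ /eqP; rewrite eqSS => pl.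
apply: (@lt_le_trans _ _ (m.+1%:R^-1 * stake R n)).
  by rewrite ltr_pdivrMr // ltr_pMr ?ltr1n // mulr_gt0 // invr_gt0.
move: pl; rewrite neq_ltn => /orP[] lp.
  by case: (value_dist_ge R n0 e_bireg e_sep lp).
by case: (value_dist_ge R n0 e_bireg e_sep lp).
Qed.
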